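(* Let $V$ be an object of $\mathcal{T}_q$ (a nondegenerate quadratic space over $\mathbb{F}_2$). Then: (1) there is a natural equivalence (isomorphism of functors) $P_V^{(0)} \simeq \iota(P^{\mathcal{F}}_{\epsilon(V)})$; (2) the functor $P_V^{(0)}$ is a direct summand of $P_V$.
   Context: A quadratic space is a finite-dimensional $\mathbb{F}_2$-vector space with a quadratic form $q$, with associated bilinear form $B(x,y)=q(x+y)+q(x)+q(y)$; it is nondegenerate if $B$ is. $\mathcal{E}$ (resp. $\mathcal{E}^f$) is the category of all (resp. finite-dimensional) $\mathbb{F}_2$-vector spaces. $\bot$ denotes orthogonal sum. $\mathcal{E}_q$: nondegenerate quadratic spaces with linear maps preserving the quadratic forms (these are injective). $\mathcal{E}_q^{\mathrm{deg}}$: possibly degenerate quadratic spaces with injective linear maps preserving the forms; the pullback of $V\xrightarrow{f}X\xleftarrow{g}W$ in it is $f(V)\cap g(W)$ with the restricted form. $\mathcal{T}_q$: same objects as $\mathcal{E}_q$; $\mathrm{Hom}_{\mathcal{T}_q}(V,W)$ is the set of equivalence classes $[V\xrightarrow{f}X\xleftarrow{g}W]$ of diagrams in $\mathcal{E}_q$, for the equivalence relation generated by: $(f,g)$ is related to $(\alpha f,\alpha g)$ for every morphism $\alpha:X\to X'$ of $\mathcal{E}_q$. Every morphism has a representative $[V\xrightarrow{f}W\bot W'\xleftarrow{i_W}W]$ with $i_W$ the canonical inclusion; composition is $[W\xrightarrow{\varphi}Z\bot L\leftarrow Z]\circ[V\xrightarrow{f}W\bot W'\leftarrow W]=[V\xrightarrow{(\varphi\bot\mathrm{Id})f}Z\bot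 L\bot W'\leftarrow Z]$. $\mathcal{F}_{quad}$ is the category of functors $\mathcal{T}_q\to\mathcal{E}$, and $P_V=\mathbb{F}_2[\mathrm{Hom}_{\mathcal{T}_q}(V,-)]$ (free vector space). Rank: $[V\to X\leftarrow W]$ has rank $i$ if the pullback of $V\to X\leftarrow W$ in $\mathcal{E}_q^{\mathrm{deg}}$ has dimension $i$. $P_V^{(i)}\subset P_V$ is the subfunctor with $P_V^{(i)}(W)$ spanned by the morphisms $V\to W$ of rank at most $i$. $\mathcal{F}$ is the category of functors $\mathcal{E}^f\to\mathcal{E}$, and $P^{\mathcal{F}}_E=\mathbb{F}_2[\mathrm{Hom}_{\mathcal{E}^f}(E,-)]$. The functor $\epsilon:\mathcal{T}_q\to\mathcal{E}^f$ sends a quadratic space to its underlying vector space and $[V\xrightarrow{f}W\bot W'\xleftarrow{i_W}W]$ to $p_W\circ f$, with $p_W$ the orthogonal projection onto $W$. $\iota:\mathcal{F}\to\mathcal{F}_{quad}$ is precomposition with $\epsilon$. *)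

(* Defs.v *)
From HB Require Import structures.
From mathcomp Require Import all_boot all_order all_algebra.
From mathcomp Require Import boolp.
From mathcomp Require Import freeg.

Set Implicit Arguments.
Unset Strict Implicit.
Unset Printing Implicit Defensive.

Import GRing.Theory VectorInternalTheory.
Local Open Scope ring_scope.


Definition F2 : fieldType := 'F_2.

Record category := Category {
  obj :> Type;
  hom : obj -> obj -> Type;
  idm : forall X, hom X X;
  cmp : forall X Y Z, hom Y Z -> hom X Y -> hom X Z;
  cmp1m : forall X Y (f : hom X Y), cmp (idm Y) f = f;
  cmpm1 : forall X Y (f : hom X Y), cmp f (idm X) = f;
  cmpA : forall X Y Z T (h : hom Z T) (g : hom Y Z) (f : hom X Y),
    cmp h (cmp g f) = cmp (cmp h g) f }.
Arguments hom {c} _ _.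
Arguments idm {c} X.
Arguments cmp {c X Y Z} _ _.

Record functor (C D : category) := Functor {
  fobj :> C -> D;
  fmap : forall X Y, hom X Y -> hom (fobj X) (fobj Y);
  fmap1 : forall X, fmap (idm X) = idm (fobj X);
  fmapM : forall X Y Z (g : hom Y Z) (f : hom X Y),
    fmap (cmp g f) = cmp (fmap g) (fmap f) }.
Arguments fmap {C D} F {X Y} _ : rename.

Record nat_trans (C D : category) (F G : functor C D) := NatTrans {
  ncomp :> forall X, hom (F X) (G X);
  ncompP : forall X Y (f : hom X Y),
    cmp (fmap G f) (ncomp X) = cmp (ncomp Y) (fmap F f) }.

Definition nat_iso (C D : category) (F G : functor C D) : Prop :=
  exists (a : nat_trans F G) (b : nat_trans G F),
    forall X, cmp (b X) (a X) = idm (F X) /\ cmp (a X) (b X) = idm (G X).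

Section FunctorComp.
Context (C D D' : category) (G : functor D D') (F : functor C D).

Lemma functor_comp1 X : fmap G (fmap F (idm X)) = idm (G (F X)).
Proof. by rewrite !fmap1. Qed.

Lemma functor_compM X Y Z (g : hom Y Z) (f : hom X Y) :
  fmap G (fmap F (cmp g f)) = cmp (fmap G (fmap F g)) (fmap G (fmap F f)).
Proof. by rewrite !fmapM. Qed.

Definition functor_comp : functor C D' :=
  Functor functor_comp1 functor_compM.
End FunctorComp.

Lemma linear_ext (R : pzRingType) (U W : lmodType R) (f g : {linear U -> W}) :
  f =1 g -> f = g.
Proof.
case: f g => f [[hf1] [hf2]] [g [[hg1] [hg2]]] /= /funext fg; subst g.
by rewrite (Prop_irrelevance hf1 hg1) (Prop_irrelevance hf2 hg2).
Qed.

Definition mklin (R : pzRingType) (U W : lmodType R) (f : U -> W)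
    (hf : linear f) : {linear U -> W} :=
  HB.pack f (GRing.isLinear.Build R U W _ f hf).

Lemma mklinE (R : pzRingType) (U W : lmodType R) (f : U -> W)
  (hf : linear f) : mklin hf =1 f.
Proof. by []. Qed.

Section VectCategories.

Let idl (U : lmodType F2) : {linear U -> U} := idfun.
Let cmpl (U W X : lmodType F2) (g : {linear W -> X}) (f : {linear U -> W}) :
  {linear U -> X} := g \o f.

Definition Vect : category.
Proof.
by refine (@Category (lmodType F2) (fun U W => {linear U -> W}) idl cmpl _ _ _)
  => *; exact: linear_ext.
Defined.

Definition fdVect : category :=
  @Category (vectType F2) (fun U W => 'Hom(U, W)) (fun U => \1%VF)
    (fun _ _ _ g f => (g \o f)%VF)
    (fun _ _ f => comp_lfun1l f) (fun _ _ f => comp_lfun1r f)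
    (fun _ _ _ _ h g f => comp_lfunA h g f).
End VectCategories.

Lemma fglift_linear (R : nzRingType) (K : choiceType) (M : lmodType R)
  (f : K -> M) : linear (fglift f : {freeg K / R} -> M).
Proof.
pose F : {additive {freeg K / R} -> M} :=
  HB.pack (fglift f : {freeg K / R} -> M)
    (GRing.isZmodMorphism.Build _ _ (fglift f) (lift_is_additive f)).
suff FZ a u : F (a *: u) = a *: F u.
  by move=> a u v; rewrite -[LHS]/(F _) raddfD FZ.
rewrite -[u in RHS]freeg_sumE -[a *: u]/(fgscale a u) /fgscale.
rewrite (raddf_sum F) [in RHS](raddf_sum F) scaler_sumr.
by apply: eq_bigr => x _; rewrite /= !liftU scalerA.
Qed.

Section Representable.
Context (C : category) (A : C).

Definition freehom (X : C) : lmodType F2 :=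
  {freeg {classic (hom A X)} / F2}.

Definition freehom_gen (X : C) (f : hom A X) : freehom X :=
  << (f : {classic (hom A X)}) >>.

Definition freehom_map (X Y : C) (g : hom X Y) : {linear freehom X -> freehom Y} :=
  mklin (fglift_linear (fun f : {classic (hom A X)} => freehom_gen (cmp g f))).

Lemma freehom_mapE (X Y : C) (g : hom X Y) (f : hom A X) :
  freehom_map g (freehom_gen f) = freehom_gen (cmp g f).
Proof. by rewrite /freehom_map mklinE liftU scale1r. Qed.

Lemma freehom_ext (X : C) (M : lmodType F2) (F G : {linear freehom X -> M}) :
  (forall f, F (freehom_gen f) = G (freehom_gen f)) -> F = G.
Proof.
move=> FG; apply: linear_ext => u.
rewrite -[u]freeg_sumE !raddf_sum; apply: eq_bigr => x _.
have -> : << coeff x u *g x >> = coeff x u *: freehom_gen x :> freehom X.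
  by apply/eqP/freeg_eqP => y; rewrite coeffZ !coeffU mul1r.
by rewrite /= !linearZ FG.
Qed.

Lemma freehom_map1 (X : C) : freehom_map (idm X) = idm (freehom X : Vect).
Proof. by apply: freehom_ext => f; rewrite freehom_mapE cmp1m. Qed.

Lemma freehom_mapM (X Y Z : C) (g : hom Y Z) (f : hom X Y) :
  freehom_map (cmp g f) =
  cmp (freehom_map g : hom (freehom Y : Vect) (freehom Z)) (freehom_map f).
Proof.
apply: freehom_ext => k; rewrite freehom_mapE.
rewrite -[RHS]/(freehom_map g (freehom_map f (freehom_gen k))).
by rewrite !freehom_mapE cmpA.
Qed.

(* F_2[Hom(A, -)] *)
Definition free_rep : functor C Vect :=
  @Functor C Vect freehom freehom_map freehom_map1 freehom_mapM.
End Representable.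

Section Submodules.
Context (U : lmodType F2).

Record submodule := Submodule {
  sm_pred :> U -> Prop;
  sm_0 : sm_pred 0;
  sm_lin : forall a u v, sm_pred u -> sm_pred v -> sm_pred (a *: u + v) }.

Definition sm_mem (S : submodule) : {pred U} := fun x => `[< S x >].

Lemma sm_memP (S : submodule) : GRing.submod_closed (sm_mem S).
Proof.
split; first exact/asboolP/sm_0.
by move=> a u v /asboolP Su /asboolP Sv; apply/asboolP/sm_lin.
Qed.

HB.instance Definition _ (S : submodule) :=
  GRing.isSubmodClosed.Build _ _ (sm_mem S) (sm_memP S).

Record sm_type (S : submodule) := SmType { sm_val : U; sm_valP : sm_val \in sm_mem S }.
HB.instance Definition _ (S : submodule) := [isSub for @sm_val S].
HB.instance Definition _ (S : submodule) := [Choice of sm_type S by <:].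
HB.instance Definition _ (S : submodule) :=
  [SubChoice_isSubLmodule of sm_type S by <:].
End Submodules.

Definition sm_incl (U : lmodType F2) (S : submodule U) : {linear sm_type S -> U} :=
  \val.

Section Span.
Context (U : lmodType F2) (A : U -> Prop).

Definition in_span (u : U) : Prop :=
  exists2 s : seq (F2 * U),
    forall p, p \in s -> A p.2 & u = \sum_(p <- s) p.1 *: p.2.

Lemma in_span0 : in_span 0.
Proof. by exists [::] => //; rewrite big_nil. Qed.

Lemma in_span_lin a u v : in_span u -> in_span v -> in_span (a *: u + v).
Proof.
case=> s As -> [t At ->]; exists ([seq (a * p.1, p.2) | p <- s] ++ t).
  by move=> p; rewrite mem_cat => /orP[/mapP[q qs ->]/=|/At//]; apply: As.
rewrite big_cat /= big_map scaler_sumr; congr (_ + _).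
by apply: eq_bigr => p _; rewrite scalerA.
Qed.

Definition span_sm : submodule U := Submodule in_span0 in_span_lin.
End Span.

Lemma in_span_map (U W : lmodType F2) (F : {linear U -> W}) (A : U -> Prop)
    (B : W -> Prop) : (forall u, A u -> B (F u)) ->
  forall u, in_span A u -> in_span B (F u).
Proof.
move=> AB _ [s As ->]; exists [seq (p.1, F p.2) | p <- s].
  by move=> _ /mapP[p /As/AB ? ->].
by rewrite big_map linear_sum; apply: eq_bigr => p _; rewrite linearZ.
Qed.

Section Subfunctors.
Context (C : category).

Record subfunctor (F : functor C Vect) := Subfunctor {
  sf_val :> forall X, submodule (F X : lmodType F2);
  sf_map : forall X Y (f : hom X Y) u, sf_val X u -> sf_val Y (fmap F f u) }.

Context (F : functor C Vect) (S : subfunctor F).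

Definition sub_obj (X : C) : Vect := sm_type (S X).

Lemma sub_map_subproof X Y (f : hom X Y) (u : sm_type (S X)) :
  fmap F f (sm_val u) \in sm_mem (S Y).
Proof. by case: u => u /= /asboolP Su; apply/asboolP/sf_map. Qed.

Definition sub_map_fun X Y (f : hom X Y) (u : sm_type (S X)) : sm_type (S Y) :=
  SmType (sub_map_subproof f u).

Lemma sub_map_linear X Y (f : hom X Y) : linear (sub_map_fun f).
Proof. by move=> a u v; apply: val_inj; rewrite /= linearP. Qed.

Definition sub_map X Y (f : hom X Y) : hom (sub_obj X) (sub_obj Y) :=
  mklin (sub_map_linear f).

Lemma sub_map1 X : sub_map (idm X) = idm (sub_obj X).
Proof. by apply: linear_ext => u; apply: val_inj; rewrite /= fmap1. Qed.

Lemma sub_mapM X Y Z (g : hom Y Z) (f : hom X Y) :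
  sub_map (cmp g f) = cmp (sub_map g) (sub_map f).
Proof. by apply: linear_ext => u; apply: val_inj; rewrite /= fmapM. Qed.

Definition sub_functor : functor C Vect :=
  @Functor C Vect sub_obj sub_map sub_map1 sub_mapM.

Definition direct_summand : Prop :=
  exists T : subfunctor F, forall X : C,
    (forall u : F X, S X u -> T X u -> u = 0) /\
    (forall u : F X, exists s t : F X, [/\ S X s, T X t & u = s + t]).
End Subfunctors.

Definition polar_form (U : lmodType F2) (q : U -> F2) (x y : U) : F2 :=
  q (x + y) + q x + q y.

(* Linearity on one side suffices, as polar_form is symmetric. *)
Definition quadratic_form (U : lmodType F2) (q : U -> F2) : Prop :=
  (forall a x, q (a *: x) = a ^+ 2 * q x) /\
  (forall y a x z, polar_form q (a *: x + z) y =
                   a * polar_form q x y + polar_form q z y).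

Definition nondegenerate (U : lmodType F2) (q : U -> F2) : Prop :=
  forall x, (forall y, polar_form q x y = 0) -> x = 0.

Record nqSpace := NqSpace {
  nq_car :> vectType F2;
  qform : nq_car -> F2;
  qformP : quadratic_form qform;
  qform_nondeg : nondegenerate qform }.

Definition polar (V : nqSpace) (x y : V) : F2 := polar_form (@qform V) x y.

Record qhom (V W : nqSpace) := Qhom {
  qmap :> 'Hom(V, W);
  qmapP : forall x, qform (qmap x) = qform x }.

Section PolarTheory.
Context (V : nqSpace).
Implicit Types x y z : V.

Lemma F2D (a : F2) : a + a = 0.
Proof. by rewrite -mulr2n -mulr_natr [2%:R](pchar_Zp (p := 2)) // mulr0. Qed.

Lemma polarC x y : polar x y = polar y x.
Proof. by rewrite /polar /polar_form addrAC [y + x]addrC. Qed.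

Lemma polarPl y a x z : polar (a *: x + z) y = a * polar x y + polar z y.
Proof. by have [_] := @qformP V; apply. Qed.

Lemma polarPr y a x z : polar y (a *: x + z) = a * polar y x + polar y z.
Proof. by rewrite polarC polarPl !(polarC y). Qed.

Lemma polarDl x y z : polar (x + y) z = polar x z + polar y z.
Proof. by have := polarPl z 1 x y; rewrite scale1r mul1r. Qed.

Lemma polar0l x : polar 0 x = 0.
Proof. by apply: (@addIr _ (polar 0 x)); rewrite -polarDl !add0r. Qed.

Lemma polarBl x y z : polar (x - y) z = polar x z - polar y z.
Proof.
have := polarPl z (-1) y x.
by rewrite scaleN1r mulN1r addrC [RHS]addrC.
Qed.

Lemma polarDr x y z : polar z (x + y) = polar z x + polar z y.
Proof. by rewrite polarC polarDl !(polarC z). Qed.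

Lemma polar0r x : polar x 0 = 0.
Proof. by rewrite polarC polar0l. Qed.

Lemma polarBr x y z : polar z (x - y) = polar z x - polar z y.
Proof. by rewrite polarC polarBl !(polarC z). Qed.

Lemma qform0 : qform (0 : V) = 0.
Proof. by have [/(_ 0 0)] := @qformP V; rewrite scale0r expr0n mul0r. Qed.

Lemma qformD x y : qform (x + y) = qform x + qform y + polar x y.
Proof.
rewrite /polar /polar_form -[X in _ = _ + X]addrA.
by rewrite [X in _ = _ + X]addrC addrA F2D add0r.
Qed.

Lemma polar_inj x y : (forall z, polar x z = polar y z) -> x = y.
Proof.
move=> xy; apply/eqP; rewrite -subr_eq0; apply/eqP/(@qform_nondeg V) => z.
by rewrite -/(polar _ _) polarBl xy subrr.
Qed.
End PolarTheory.

Definition lfun_of (U W : vectType F2) (f : U -> W) (hf : linear f) : 'Hom(U, W) :=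
  linfun (mklin hf).

Lemma lfun_ofE (U W : vectType F2) (f : U -> W) (hf : linear f) x :
  lfun_of hf x = f x.
Proof. by rewrite /lfun_of lfunE. Qed.

Lemma riesz (W : nqSpace) (phi : W -> F2^o) : linear phi ->
  exists w, forall x, polar w x = phi x.
Proof.
move=> lphi.
have lpol (w : W) : linear (polar w : W -> F2^o).
  by move=> a x y; rewrite polarPr.
have ladj : linear (fun w => lfun_of (lpol w)).
  move=> a x y; apply/lfunP => z.
  by rewrite !(add_lfunE, scale_lfunE, lfun_ofE) polarPl.
pose adj := lfun_of ladj.
have kadj : lker adj == 0%VS.
  apply/lker0P => x y /lfunP xy; apply: polar_inj => z.
  by have := xy z; rewrite !lfun_ofE.
have /memv_imgP[w _ phiE] : lfun_of lphi \in limg adj.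
  suff -> : limg adj = fullv by rewrite memvf.
  apply/eqP; rewrite eqEdim subvf limg_dim_eq ?(eqP kadj) ?capv0 //.
  by rewrite !dimvf /= /dim /= muln1.
by exists w => x; have /lfunP/(_ x) := phiE; rewrite !lfun_ofE.
Qed.

Section Qhom.

Lemma qhom_ext V W (f g : qhom V W) : f =1 g -> f = g.
Proof.
case: f g => f pf [g pg] /= /lfunP fg; subst g.
by rewrite (Prop_irrelevance pf pg).
Qed.

Lemma qhom_polar V W (f : qhom V W) x y : polar (f x) (f y) = polar x y.
Proof. by rewrite /polar /polar_form -linearD !qmapP. Qed.

Lemma qhomPZ V W (f : qhom V W) a x y : f (a *: x + y) = a *: f x + f y.
Proof. exact: linearP. Qed.

Lemma qhomD V W (f : qhom V W) x y : f (x + y) = f x + f y.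
Proof. exact: linearD. Qed.

Lemma qhomB V W (f : qhom V W) x y : f (x - y) = f x - f y.
Proof. exact: linearB. Qed.

Lemma qhom_inj V W (f : qhom V W) : injective f.
Proof.
by move=> x y fxy; apply: polar_inj => z; rewrite -!(qhom_polar f) fxy.
Qed.

Lemma qid_subproof (V : nqSpace) (x : V) : qform ((\1%VF : 'Hom(V, V)) x) = qform x.
Proof. by rewrite id_lfunE. Qed.
Definition qid (V : nqSpace) : qhom V V := Qhom (@qid_subproof V).

Lemma qcomp_subproof V W X (g : qhom W X) (f : qhom V W) x :
  qform ((g \o f)%VF x) = qform x.
Proof. by rewrite comp_lfunE !qmapP. Qed.
Definition qcomp V W X (g : qhom W X) (f : qhom V W) : qhom V X :=
  Qhom (qcomp_subproof g f).

Lemma qidE (V : nqSpace) (x : V) : qid V x = x. Proof. exact: id_lfunE. Qed.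
Lemma qcompE V W X (g : qhom W X) (f : qhom V W) x : qcomp g f x = g (f x).
Proof. exact: comp_lfunE. Qed.

Lemma mkqhom_subproof (V W : nqSpace) (f : V -> W) (lf : linear f)
  (pf : forall x, qform (f x) = qform x) x : qform (lfun_of lf x) = qform x.
Proof. by rewrite lfun_ofE. Qed.
Definition mkqhom (V W : nqSpace) (f : V -> W) lf pf : qhom V W :=
  Qhom (@mkqhom_subproof V W f lf pf).
Lemma mkqhomE (V W : nqSpace) (f : V -> W) lf pf x : @mkqhom V W f lf pf x = f x.
Proof. exact: lfun_ofE. Qed.
End Qhom.

Section OrthogonalSum.
Context (V W : nqSpace).

Definition osum_form (x : V * W) : F2 := qform x.1 + qform x.2.

Lemma osum_polar x y :
  polar_form osum_form x y = polar x.1 y.1 + polar x.2 y.2.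
Proof.
rewrite /polar /polar_form /osum_form /=.
by rewrite [RHS]addrACA; congr (_ + _); exact: addrACA.
Qed.

Lemma osum_quadratic : quadratic_form osum_form.
Proof.
split=> [a x|y a x z].
  have [[qV _] [qW _]] := (@qformP V, @qformP W).
  by rewrite /osum_form /= qV qW mulrDr.
by rewrite !osum_polar /= !polarPl addrACA -mulrDr.
Qed.

Lemma osum_nondegenerate : nondegenerate osum_form.
Proof.
case=> x x' h; congr (_, _).
  apply: polar_inj => z; have := h (z, 0).
  by rewrite osum_polar /= polar0r addr0 polar0l.
apply: polar_inj => z; have := h (0, z).
by rewrite osum_polar /= polar0r add0r polar0l.
Qed.

Definition osum : nqSpace := NqSpace osum_quadratic osum_nondegenerate.

Lemma osum_inl_linear : linear (fun x : V => (x, 0) : osum).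
Proof. by move=> a x y; congr (_, _); rewrite /= scaler0 addr0. Qed.
Lemma osum_inl_qform x : qform ((x, 0) : osum) = qform x.
Proof. by rewrite /= /osum_form /= qform0 addr0. Qed.
Definition osum_inl : qhom V osum := mkqhom osum_inl_linear osum_inl_qform.
Lemma osum_inlE x : osum_inl x = (x, 0). Proof. exact: mkqhomE. Qed.

Lemma osum_fst_linear : linear (fun x : osum => x.1 : V).
Proof. by []. Qed.
Definition osum_fst : 'Hom(osum, V) := lfun_of osum_fst_linear.
Lemma osum_fstE x : osum_fst x = x.1. Proof. exact: lfun_ofE. Qed.
End OrthogonalSum.

Section OsumMap.
Context (V V' W W' : nqSpace) (f : qhom V V') (g : qhom W W').

Lemma osum_map_linear :
  linear (fun x : osum V W => (f x.1, g x.2) : osum V' W').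
Proof. by move=> a x y; congr (_, _); rewrite linearP. Qed.
Lemma osum_map_qform (x : osum V W) :
  qform ((f x.1, g x.2) : osum V' W') = qform x.
Proof. by rewrite /= /osum_form /= !qmapP. Qed.
Definition osum_map : qhom (osum V W) (osum V' W') :=
  mkqhom osum_map_linear osum_map_qform.
Lemma osum_mapE x : osum_map x = (f x.1, g x.2). Proof. exact: mkqhomE. Qed.
End OsumMap.

(* A square of isometries g : W -> X, h : W -> Y, a : X -> P, b : Y -> P which
   exhibits a(X) + b(Y) as the orthogonal sum of W, of the orthogonal
   complement of g(W) in X and of that of h(W) in Y. *)
Definition orth_square (W X Y P : nqSpace) (g : qhom W X) (h : qhom W Y)
    (a : qhom X P) (b : qhom Y P) : Prop :=
  (forall w, a (g w) = b (h w)) /\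
  (forall x y, (forall w, polar x (g w) = 0) -> (forall w, polar y (h w) = 0) ->
     polar (a x) (b y) = 0).

Section OrthProj.
Context (W X : nqSpace) (g : qhom W X).

Lemma orth_proj_ex : exists p : 'Hom(X, W),
  forall x w, polar (p x) w = polar x (g w).
Proof.
have lphi (x : X) : linear (fun w => polar x (g w) : F2^o).
  by move=> a u v; rewrite linearP polarPr.
pose p x := projT1 (cid (riesz (lphi x))).
have pP x w : polar (p x) w = polar x (g w).
  by rewrite /p; case: cid => /= y ->.
have lp : linear p.
  by move=> a x y; apply: polar_inj => w; rewrite polarPl !pP polarPl.
by exists (lfun_of lp) => x w; rewrite lfun_ofE pP.
Qed.

Definition orth_proj : 'Hom(X, W) := projT1 (cid orth_proj_ex).
Lemma orth_projP x w : polar (orth_proj x) w = polar x (g w).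
Proof. by rewrite /orth_proj; case: cid. Qed.

Lemma orth_projK w : orth_proj (g w) = w.
Proof. by apply: polar_inj => z; rewrite orth_projP qhom_polar. Qed.

Lemma orth_proj0P x :
  orth_proj x = 0 <-> (forall w, polar x (g w) = 0).
Proof.
split=> [px w|h]; first by rewrite -orth_projP px polar0l.
by apply: polar_inj => w; rewrite orth_projP h polar0l.
Qed.

Lemma orth_rest x w : polar (x - g (orth_proj x)) (g w) = 0.
Proof. by rewrite polarBl qhom_polar orth_projP subrr. Qed.

Definition compl_car := subvs_of (lker orth_proj).
Definition compl_form (x : compl_car) : F2 := qform (vsval x).

Lemma compl_polar x y : polar_form compl_form x y = polar (vsval x) (vsval y).
Proof. by rewrite /polar_form /compl_form linearD. Qed.

Lemma compl_orth (x : compl_car) w : polar (vsval x) (g w) = 0.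
Proof. by move: w; apply/orth_proj0P/eqP; rewrite -memv_ker subvsP. Qed.

Lemma compl_quadratic : quadratic_form compl_form.
Proof.
split=> [a x|y a x z]; last by rewrite !compl_polar linearP polarPl.
by have [qX _] := @qformP X; rewrite /compl_form linearZ qX.
Qed.

Lemma compl_mem x : x - g (orth_proj x) \in lker orth_proj.
Proof. by rewrite memv_ker; apply/eqP/orth_proj0P/orth_rest. Qed.

Lemma compl_nondegenerate : nondegenerate compl_form.
Proof.
move=> x h; apply: val_inj; apply: polar_inj => z /=; rewrite polar0l.
rewrite -[z](subrK (g (orth_proj z))) polarDr compl_orth addr0.
have := h (Subvs (compl_mem z)).
by rewrite compl_polar.
Qed.

Definition compl : nqSpace := NqSpace compl_quadratic compl_nondegenerate.

Definition compl_part (x : X) : compl := Subvs (compl_mem x).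

Lemma compl_part_linear : linear compl_part.
Proof.
move=> a x y; apply: val_inj; rewrite /= [orth_proj _]linearP qhomPZ.
by rewrite scalerBr opprD addrACA.
Qed.

Lemma orth_split x : x = g (orth_proj x) + vsval (compl_part x).
Proof. by rewrite /= addrC subrK. Qed.

Lemma orth_qform x : qform x = qform (orth_proj x) + qform (compl_part x).
Proof.
rewrite {1}[x]orth_split qformD qmapP polarC compl_orth addr0.
by [].
Qed.
End OrthProj.

Section OrthSquare.

Lemma orth_square_strong W X Y P (g : qhom W X) (h : qhom W Y) (a : qhom X P)
    (b : qhom Y P) : orth_square g h a b ->
  forall x y, (forall w, polar x (g w) = 0) -> polar (a x) (b y) = 0.
Proof.
move=> [com ort] x y xg; rewrite [y](orth_split h) qhomD polarDr -com.
rewrite qhom_polar xg add0r; apply: ort => // w; exact: compl_orth.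
Qed.

Lemma orth_square_sym W X Y P (g : qhom W X) (h : qhom W Y) (a : qhom X P)
    (b : qhom Y P) : orth_square g h a b -> orth_square h g b a.
Proof.
by move=> [com ort]; split=> [w|x y xh yg]; [rewrite com | rewrite polarC ort].
Qed.

Lemma orth_square_univ W X Y (g : qhom W X) (h : qhom W Y) :
  exists P0 (a0 : qhom X P0) (b0 : qhom Y P0), orth_square g h a0 b0 /\
    forall P (a : qhom X P) (b : qhom Y P), orth_square g h a b ->
      exists m : qhom P0 P, a = qcomp m a0 /\ b = qcomp m b0.
Proof.
pose a0f x : osum Y (compl g) := (h (orth_proj g x), compl_part g x).
have la0 : linear a0f.
  move=> s x y; rewrite /a0f compl_part_linear !linearP.
  by congr (_, _).
have qa0 x : qform (a0f x) = qform x.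
  by rewrite [RHS](orth_qform g) /= /osum_form /= qmapP.
have a0E := mkqhomE la0 qa0.
exists (osum Y (compl g)), (mkqhom la0 qa0), (osum_inl Y (compl g)).
split.
  split=> [w|x y xg yh].
    rewrite a0E mkqhomE /a0f orth_projK; congr (_, _); apply: val_inj => /=.
    by rewrite orth_projK subrr.
  rewrite a0E mkqhomE /polar osum_polar /=.
  have /(orth_proj0P g) -> := xg.
  by rewrite linear0 polar0l polar0r addr0.
move=> P a b sq; have [com ort] := sq.
pose mf (z : osum Y (compl g)) := b z.1 + a (vsval z.2).
have lm : linear mf.
  move=> s x y; rewrite /mf /= !linearP /=.
  by rewrite scalerDr addrACA.
have qm z : qform (mf z) = qform z.
  rewrite /mf qformD !qmapP polarC (orth_square_strong sq) ?addr0 // => w.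
  exact: compl_orth.
exists (mkqhom lm qm); split; apply: qhom_ext => x; rewrite qcompE !mkqhomE.
  rewrite /mf /a0f /= -com -qhomD; congr (a _).
  exact: orth_split.
by rewrite /mf /= linear0 addr0.
Qed.
End OrthSquare.

Record diagram (V W : nqSpace) := Diagram {
  dg_sp : nqSpace;
  dg_l : qhom V dg_sp;
  dg_r : qhom W dg_sp }.

Inductive dg_eq (V W : nqSpace) : diagram V W -> diagram V W -> Prop :=
| DgStep X X' (f : qhom V X) (g : qhom W X) (a : qhom X X') :
    dg_eq (Diagram f g) (Diagram (qcomp a f) (qcomp a g))
| DgRefl d : dg_eq d d
| DgSym d e : dg_eq d e -> dg_eq e d
| DgTrans d e k : dg_eq d e -> dg_eq e k -> dg_eq d k.

(* All diagrams between two spaces form a type that is too large to carry a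
   free vector space.  A morphism of T_q is therefore represented by the trace
   of an equivalence class of diagrams on the diagrams whose middle object has
   underlying space F_2^n; by tq_mk_eq and tq_mk_surj, tq_hom V W is the
   quotient of diagram V W by dg_eq. *)
Record cspace := Cspace {
  cs_dim : nat;
  cs_form : 'rV[F2]_cs_dim -> F2;
  cs_quad : quadratic_form cs_form;
  cs_nondeg : nondegenerate cs_form }.

Definition cspace_nq (X : cspace) : nqSpace := NqSpace (@cs_quad X) (@cs_nondeg X).

Record cdiagram (V W : nqSpace) := Cdiagram {
  cd_sp : cspace;
  cd_l : qhom V (cspace_nq cd_sp);
  cd_r : qhom W (cspace_nq cd_sp) }.

Definition cd_dg V W (c : cdiagram V W) : diagram V W := Diagram (cd_l c) (cd_r c).

Record tq_hom (V W : nqSpace) := TqHom {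
  tq_class : cdiagram V W -> Prop;
  tq_classP : exists d, tq_class = fun c => dg_eq d (cd_dg c) }.

Definition tq_mk V W (d : diagram V W) : tq_hom V W :=
  TqHom (ex_intro _ d erefl).

Lemma tq_mk_surj V W (u : tq_hom V W) : exists d, u = tq_mk d.
Proof.
case: u => C [d Cd]; exists d; subst C.
by rewrite /tq_mk; congr TqHom.
Qed.

Lemma cdiagram_ex V W (d : diagram V W) : exists c, dg_eq d (@cd_dg V W c).
Proof.
case: d => X f g.
pose q (x : 'rV[F2]_(dim X)) : F2 := qform (r2v x : X).
have qpol x y : polar_form q x y = polar (r2v x : X) (r2v y : X).
  by rewrite /polar_form /q linearD.
have qq : quadratic_form q.
  split=> [a x|y a x z]; last by rewrite !qpol linearP polarPl.
  by have [qX _] := @qformP X; rewrite /q linearZ qX.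
have qn : nondegenerate q.
  move=> x h; apply: (can_inj (@r2vK _ X)); rewrite linear0.
  apply: polar_inj => y; rewrite polar0l -[y]v2rK -qpol.
  exact: h.
pose C := Cspace qq qn.
have lv : linear (v2r : X -> cspace_nq C) by move=> a x y; rewrite linearP.
have qv (x : X) : @qform (cspace_nq C) (v2r x) = qform x.
  by rewrite /= /q v2rK.
pose a : qhom X (cspace_nq C) := mkqhom lv qv.
exists (@Cdiagram V W C (qcomp a f) (qcomp a g)).
exact: DgStep.
Qed.

Lemma tq_mk_eq V W (d e : diagram V W) : tq_mk d = tq_mk e <-> dg_eq d e.
Proof.
split=> [[dE]|de].
  have [c dc] := cdiagram_ex d; apply: (DgTrans dc); apply: DgSym.
  by have := congr1 (fun C => C c) dE => /= <-.
have E : (fun c => dg_eq d (cd_dg c)) = (fun c => dg_eq e (cd_dg c)).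
  apply/funext => c; apply/propext; split=> h.
    exact: DgTrans (DgSym de) h.
  exact: DgTrans de h.
rewrite /tq_mk; move: (ex_intro _ d _) (ex_intro _ e _); rewrite E => p p'.
by congr TqHom.
Qed.

(* A diagram of the form V -> W _|_ W' <- W, with the canonical inclusion. *)
Record split_diagram (V W : nqSpace) := SplitDiagram {
  sd_compl : nqSpace;
  sd_map : qhom V (osum W sd_compl) }.

Definition sd_dg V W (s : split_diagram V W) : diagram V W :=
  Diagram (sd_map s) (osum_inl W (sd_compl s)).

Lemma split_diagram_ex V W (u : tq_hom V W) : exists s, u = tq_mk (@sd_dg V W s).
Proof.
have [[X f g] ->] := tq_mk_surj u.
pose tf (x : X) : osum W (compl g) := (orth_proj g x, compl_part g x).
have lt : linear tf by move=> a x y; rewrite /tf compl_part_linear linearP.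
have qt x : qform (tf x) = qform x by rewrite [RHS](orth_qform g).
pose t := mkqhom lt qt.
exists (@SplitDiagram V W (compl g) (qcomp t f)); apply/tq_mk_eq.
have -> : sd_dg (@SplitDiagram V W (compl g) (qcomp t f))
          = Diagram (qcomp t f) (qcomp t g).
  congr Diagram; apply: qhom_ext => w; rewrite qcompE !mkqhomE /tf orth_projK.
  by congr (_, _); apply: val_inj; rewrite /= orth_projK subrr.
exact: DgStep.
Qed.

Definition tq_split V W (u : tq_hom V W) : split_diagram V W :=
  projT1 (cid (split_diagram_ex u)).

Lemma tq_splitE V W (u : tq_hom V W) : tq_mk (sd_dg (tq_split u)) = u.
Proof. by rewrite /tq_split; case: cid => s /= <-. Qed.

Definition tq_id (V : nqSpace) : tq_hom V V := tq_mk (Diagram (qid V) (qid V)).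

(* [W -phi-> Z _|_ L <- Z] o [V -f-> W _|_ W' <- W]
   = [V -(phi _|_ Id) f-> Z _|_ L _|_ W' <- Z]; by
   tq_comp_split the result does not depend on the chosen representatives. *)
Definition sd_comp V W Z (t : split_diagram W Z) (s : split_diagram V W) :
    diagram V Z :=
  Diagram (qcomp (osum_map (sd_map t) (qid (sd_compl s))) (sd_map s))
          (qcomp (osum_inl (osum Z (sd_compl t)) (sd_compl s))
                 (osum_inl Z (sd_compl t))).

Definition tq_comp V W Z (v : tq_hom W Z) (u : tq_hom V W) : tq_hom V Z :=
  tq_mk (sd_comp (tq_split v) (tq_split u)).

Lemma qcompA V W X Y (h : qhom X Y) (g : qhom W X) (f : qhom V W) :
  qcomp h (qcomp g f) = qcomp (qcomp h g) f.
Proof. by apply: qhom_ext => x; rewrite !qcompE. Qed.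

Lemma orth_square_uniq V W Z X Y P P' (g : qhom W X) (h : qhom W Y)
    (f : qhom V X) (k : qhom Z Y) (a : qhom X P) (b : qhom Y P)
    (a' : qhom X P') (b' : qhom Y P') :
  orth_square g h a b -> orth_square g h a' b' ->
  dg_eq (Diagram (qcomp a f) (qcomp b k)) (Diagram (qcomp a' f) (qcomp b' k)).
Proof.
have [P0 [a0 [b0 [_ univ]]]] := orth_square_univ g h.
move=> /univ[m [-> ->]] /univ[m' [-> ->]].
apply: (@DgTrans _ _ _ (Diagram (qcomp a0 f) (qcomp b0 k))).
  by apply: DgSym; rewrite -!qcompA; exact: DgStep.
by rewrite -!qcompA; exact: DgStep.
Qed.

Lemma orth_square_eql V W Z (d d' : diagram V W) (e : diagram W Z) P P'
    (a : qhom (dg_sp d) P) (b : qhom (dg_sp e) P)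
    (a' : qhom (dg_sp d') P') (b' : qhom (dg_sp e) P') :
  dg_eq d d' ->
  orth_square (dg_r d) (dg_l e) a b -> orth_square (dg_r d') (dg_l e) a' b' ->
  dg_eq (Diagram (qcomp a (dg_l d)) (qcomp b (dg_r e)))
        (Diagram (qcomp a' (dg_l d')) (qcomp b' (dg_r e))).
Proof.
move=> dd'; elim: dd' P P' a b a' b' => {d d'}.
- move=> X X' f g m P P' a b a' b' /= sq [com ort].
  rewrite [in X in dg_eq _ X]qcompA; apply: (orth_square_uniq _ _ sq).
  split=> [w|x y xg yh]; first by have := com w; rewrite !qcompE.
  rewrite qcompE; apply: ort => // w; by rewrite qcompE qhom_polar.
- by move=> d P P' a b a' b'; exact: orth_square_uniq.
- by move=> d d' _ IH P P' a b a' b' sq sq'; apply: DgSym; apply: IH.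
- move=> d d' d'' _ IH1 _ IH2 P P' a b a' b' sq sq'.
  have [Q [m [n [sqQ _]]]] := orth_square_univ (dg_r d') (dg_l e).
  exact: DgTrans (IH1 _ _ _ _ _ _ sq sqQ) (IH2 _ _ _ _ _ _ sqQ sq').
Qed.

Definition dg_flip V W (d : diagram V W) : diagram W V := Diagram (dg_r d) (dg_l d).

Lemma dg_eq_flip V W (d e : diagram V W) : dg_eq d e -> dg_eq (dg_flip d) (dg_flip e).
Proof.
elim=> {d e}; [move=> *|move=> *|move=> *|move=> d e k _ h1 _ h2].
- exact: DgStep.
- exact: DgRefl.
- exact: DgSym.
- exact: DgTrans h1 h2.
Qed.

Lemma orth_square_eq V W Z (d d' : diagram V W) (e e' : diagram W Z) P P'
    (a : qhom (dg_sp d) P) (b : qhom (dg_sp e) P)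
    (a' : qhom (dg_sp d') P') (b' : qhom (dg_sp e') P') :
  dg_eq d d' -> dg_eq e e' ->
  orth_square (dg_r d) (dg_l e) a b -> orth_square (dg_r d') (dg_l e') a' b' ->
  dg_eq (Diagram (qcomp a (dg_l d)) (qcomp b (dg_r e)))
        (Diagram (qcomp a' (dg_l d')) (qcomp b' (dg_r e'))).
Proof.
move=> dd' /dg_eq_flip ee' sq sq'.
have [Q [m [n [sqQ _]]]] := orth_square_univ (dg_r d') (dg_l e).
apply: DgTrans (orth_square_eql dd' sq sqQ) _.
have /dg_eq_flip := @orth_square_eql _ _ _ (dg_flip e) (dg_flip e') (dg_flip d') _ _
  n m b' a' ee' (orth_square_sym sqQ) (orth_square_sym sq').
by [].
Qed.

Lemma sd_square V W Z (t : split_diagram W Z) (s : split_diagram V W) :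
  orth_square (dg_r (sd_dg s)) (dg_l (sd_dg t))
    (osum_map (sd_map t) (qid (sd_compl s)))
    (osum_inl (osum Z (sd_compl t)) (sd_compl s)).
Proof.
split=> [w|x y xw yw]; first by rewrite osum_mapE !osum_inlE /= qidE.
rewrite osum_mapE osum_inlE /polar osum_polar /= polar0r addr0.
have -> : x.1 = 0.
  apply: polar_inj => w; rewrite polar0l -(xw w) osum_inlE [RHS]osum_polar /=.
  by rewrite polar0r addr0.
by rewrite linear0 polar0l.
Qed.

Lemma tq_compE V W Z (d : diagram V W) (e : diagram W Z) P
    (a : qhom (dg_sp d) P) (b : qhom (dg_sp e) P) :
  orth_square (dg_r d) (dg_l e) a b ->
  tq_comp (tq_mk e) (tq_mk d) =
  tq_mk (Diagram (qcomp a (dg_l d)) (qcomp b (dg_r e))).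
Proof.
move=> sq; apply/tq_mk_eq.
have /tq_mk_eq dE := tq_splitE (tq_mk d).
have /tq_mk_eq eE := tq_splitE (tq_mk e).
exact: (orth_square_eq dE eE (sd_square _ _) sq).
Qed.

Lemma tq_comp_split V W Z (t : split_diagram W Z) (s : split_diagram V W) :
  tq_comp (tq_mk (sd_dg t)) (tq_mk (sd_dg s)) = tq_mk (sd_comp t s).
Proof. exact: tq_compE (sd_square t s). Qed.

Lemma tq_comp1m V W (u : tq_hom V W) : tq_comp (tq_id W) u = u.
Proof.
have [[X f g] ->] := tq_mk_surj u.
rewrite (@tq_compE _ _ _ (Diagram f g) (Diagram (qid W) (qid W)) X (qid X) g) /=.
  by congr (tq_mk (Diagram _ _)); apply: qhom_ext => x; rewrite qcompE !qidE.
split=> [w|x y xg yh] /=; first by rewrite !qidE.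
by rewrite qidE.
Qed.

Lemma tq_compm1 V W (u : tq_hom V W) : tq_comp u (tq_id V) = u.
Proof.
have [[X f g] ->] := tq_mk_surj u.
rewrite (@tq_compE _ _ _ (Diagram (qid V) (qid V)) (Diagram f g) X f (qid X)) /=.
  by congr (tq_mk (Diagram _ _)); apply: qhom_ext => x; rewrite qcompE !qidE.
split=> [w|x y xg yh] /=; first by rewrite !qidE.
by rewrite qidE polarC yh.
Qed.

Lemma tq_compA V W Y Z (w : tq_hom Y Z) (v : tq_hom W Y) (u : tq_hom V W) :
  tq_comp w (tq_comp v u) = tq_comp (tq_comp w v) u.
Proof.
have [[X f g] ->] := tq_mk_surj u.
have [[X' h k] ->] := tq_mk_surj v.
have [[X'' m n] ->] := tq_mk_surj w.
have [P [a [b [sqP _]]]] := orth_square_univ g h.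
have [R [c [r [sqR _]]]] := orth_square_univ k m.
have [Q [s [t [sqQ _]]]] := orth_square_univ b c.
have [comP _] := sqP; have [comR _] := sqR; have [comQ _] := sqQ.
rewrite (@tq_compE _ _ _ (Diagram f g) (Diagram h k) P a b) //=.
rewrite (@tq_compE _ _ _ (Diagram h k) (Diagram m n) R c r) //=.
rewrite (@tq_compE _ _ _ (Diagram (qcomp a f) (qcomp b k)) (Diagram m n) Q s (qcomp t r)) /=.
  rewrite (@tq_compE _ _ _ (Diagram f g) (Diagram (qcomp c h) (qcomp r n)) Q (qcomp s a) t) /=.
    by rewrite !qcompA.
  split=> [z|x y xg yh]; first by rewrite !qcompE comP comQ.
  rewrite qcompE; apply: (orth_square_strong sqQ) => z.
  exact: (orth_square_strong sqP).
split=> [z|x y xg yh]; first by rewrite !qcompE comQ comR.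
rewrite qcompE polarC; apply: (orth_square_strong (orth_square_sym sqQ)) => z.
exact: (orth_square_strong (orth_square_sym sqR)).
Qed.

Definition Tq : category :=
  @Category nqSpace tq_hom tq_id tq_comp tq_comp1m tq_compm1 tq_compA.

(* [V -f-> W _|_ W' <- W] is sent to p_W o f; by eps_map_split this does not
   depend on the representative. *)
Definition eps_map V W (u : tq_hom V W) : 'Hom(V, W) :=
  (osum_fst W (sd_compl (tq_split u)) \o sd_map (tq_split u))%VF.

Lemma eps_map_polar V W (d : diagram V W) v w :
  polar (eps_map (tq_mk d) v) w = polar (dg_l d v) (dg_r d w).
Proof.
have /tq_mk_eq := tq_splitE (tq_mk d).
have -> : polar (eps_map (tq_mk d) v) w =
    polar (dg_l (sd_dg (tq_split (tq_mk d))) v)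
          (dg_r (sd_dg (tq_split (tq_mk d))) w).
  rewrite /= osum_inlE [RHS]osum_polar /= polar0r addr0 /eps_map.
  by rewrite comp_lfunE osum_fstE.
move: (sd_dg _) => S; elim=> {d S} [X X' f g a|//|d e _ ->//|d e k _ -> _ ->//].
by rewrite /= !qcompE qhom_polar.
Qed.

Lemma eps_map_split V W (s : split_diagram V W) :
  eps_map (tq_mk (sd_dg s)) = (osum_fst W (sd_compl s) \o sd_map s)%VF.
Proof.
apply/lfunP => v; apply: polar_inj => w.
rewrite eps_map_polar comp_lfunE osum_fstE /= osum_inlE [LHS]osum_polar /=.
by rewrite polar0r addr0.
Qed.

Lemma eps_map1 V : eps_map (tq_id V) = \1%VF.
Proof.
apply/lfunP => v; apply: polar_inj => w.
by rewrite eps_map_polar !qidE.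
Qed.

Lemma eps_mapM V W Z (v : tq_hom W Z) (u : tq_hom V W) :
  eps_map (tq_comp v u) = (eps_map v \o eps_map u)%VF.
Proof.
have [[X f g] ->] := tq_mk_surj u; have [[Y h k] ->] := tq_mk_surj v.
have [P [a [b [sq _]]]] := orth_square_univ g h; have [com _] := sq.
rewrite (@tq_compE _ _ _ (Diagram f g) (Diagram h k) P a b) //=.
apply/lfunP => x; apply: polar_inj => z; rewrite comp_lfunE !eps_map_polar /=.
rewrite !qcompE [f x](orth_split g) qhomD polarDl com qhom_polar.
rewrite (orth_square_strong sq) ?addr0 => [|w]; last exact: compl_orth.
congr (polar (h _) _); apply: polar_inj => w.
by rewrite orth_projP eps_map_polar.
Qed.

Definition eps : functor Tq fdVect :=
  @Functor Tq fdVect nq_car eps_map eps_map1 eps_mapM.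

(* The dimension of the pullback f(V) /\ g(W) of V -f-> X <-g- W in the
   category of possibly degenerate quadratic spaces. *)
Definition dg_rank V W (d : diagram V W) : nat :=
  \dim (limg (dg_l d) :&: limg (dg_r d))%VS.

Definition tq_rank V W (u : tq_hom V W) : nat := dg_rank (sd_dg (tq_split u)).

Lemma dg_rank_eq V W (d e : diagram V W) : dg_eq d e -> dg_rank d = dg_rank e.
Proof.
elim=> {d e} [X X' f g a|//|d e _ ->//|d e k _ -> _ ->//].
rewrite /dg_rank /= !limg_comp.
have ka : lker a == 0%VS by apply/lker0P/qhom_inj.
by rewrite -lker0_img_cap // limg_dim_eq // (eqP ka) capv0.
Qed.

Lemma tq_rankE V W (d : diagram V W) : tq_rank (tq_mk d) = dg_rank d.
Proof. exact/dg_rank_eq/tq_mk_eq/tq_splitE. Qed.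

Lemma tq_rank_comp V W Z (v : tq_hom W Z) (u : tq_hom V W) :
  (tq_rank (tq_comp v u) <= tq_rank u)%N.
Proof.
have [[X f g] ->] := tq_mk_surj u; have [[Y h k] ->] := tq_mk_surj v.
have [P [a [b [sq _]]]] := orth_square_univ g h; have [com _] := sq.
rewrite (@tq_compE _ _ _ (Diagram f g) (Diagram h k) P a b) //=.
rewrite !tq_rankE /dg_rank /=.
have ka : lker a == 0%VS by apply/lker0P/qhom_inj.
have <- : \dim (a @: (limg f :&: limg g)) = \dim (limg f :&: limg g).
  by rewrite limg_dim_eq // (eqP ka) capv0.
apply/dimvS/subvP => y /memv_capP[/memv_imgP[x _ ->] /memv_imgP[z _]].
rewrite !qcompE => e.
apply/memv_img/memv_capP; split; first by rewrite memv_img ?memvf.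
rewrite [f x](orth_split g); set r := vsval _.
suff -> : r = 0 by rewrite addr0 memv_img ?memvf.
have ar0 y' : polar (a r) (b y') = 0.
  by apply: (orth_square_strong sq) => w; exact: compl_orth.
have arb : a r = b (k z - h (orth_proj g (f x))).
  move: e; rewrite {1}[f x](orth_split g) qhomD com => e.
  by rewrite [RHS]qhomB -e addrAC subrr add0r.
have /qhom_inj kh : b (k z - h (orth_proj g (f x))) = b 0.
  congr (b _); apply: polar_inj => y'.
  by rewrite polar0l -(qhom_polar b) -arb ar0.
by apply: (@qhom_inj _ _ a); rewrite arb kh !linear0.
Qed.

Definition PTq (V : Tq) : functor Tq Vect := free_rep V.

Definition PTq_rank_gen (V : Tq) (i : nat) (W : Tq) (x : freehom V W) : Prop :=
  exists2 u : tq_hom V W, (tq_rank u <= i)%N & x = @freehom_gen Tq V W u.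

Lemma PTq_rank_map (V : Tq) (i : nat) (W Z : Tq) (v : hom W Z) (x : freehom V W) :
  span_sm (@PTq_rank_gen V i W) x ->
  span_sm (@PTq_rank_gen V i Z) (fmap (PTq V) v x).
Proof.
apply: in_span_map => _ [u ru ->]; exists (tq_comp v u).
  exact: leq_trans (tq_rank_comp v u) ru.
exact: freehom_mapE.
Qed.

Definition PTq_rank (V : Tq) (i : nat) : subfunctor (PTq V) :=
  @Subfunctor Tq (PTq V) (fun W => span_sm (@PTq_rank_gen V i W)) (PTq_rank_map (i := i)).

Definition PF (E : fdVect) : functor fdVect Vect := free_rep E.

Definition iotaF (F : functor fdVect Vect) : functor Tq Vect := functor_comp F eps.

(* Main.v *)
From mathcomp Require Import all_boot all_algebra.
From mathcomp Require Import boolp freeg.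
Require Import Defs.

(** A morphism [V -f-> X <-g- W] of rank 0 is determined by its image
    [p : V -> W] under [eps]: rank 0 means that [(v, w) |-> f v + g w] is
    injective, and [p] determines the form it induces on [V * W].  As two
    nondegenerate spaces containing the same (possibly degenerate) subspace
    embed isometrically in a third one, compatibly with this subspace, two rank
    0 diagrams with the same [p] are equivalent.  Conversely [p] is the image of
    [v |-> (p v, (v, 0))] into [W _|_ (V * V)], where [V * V] carries a
    nondegenerate form restricting to [q v + q (p v)] on the first factor.
    Hence [eps] linearises to a natural map [PTq V -> iotaF (PF (eps V))] whose
    restriction to the rank 0 part is bijective, and the kernel of this map is a
    complement of the rank 0 part. *)

Set Implicit Arguments.
Unset Strict Implicit.
Unset Printing Implicit Defensive.

Import GRing.Theory.
Local Open Scope ring_scope.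

(** * Sums, pullbacks and diagonals of quadratic forms *)

Section QuadraticForms.
Context (U : lmodType F2).
Implicit Types (p q : U -> F2) (b : U -> U -> F2).

Lemma polar_formD p q x y :
  polar_form (fun z => p z + q z) x y = polar_form p x y + polar_form q x y.
Proof. by rewrite /polar_form [X in X + _ = _]addrACA [LHS]addrACA. Qed.

Lemma quadratic_formD p q : quadratic_form p -> quadratic_form q ->
  quadratic_form (fun z => p z + q z).
Proof.
move=> [pZ pP] [qZ qP]; split=> [a x|y a x z]; first by rewrite pZ qZ mulrDr.
by rewrite !polar_formD pP qP addrACA -mulrDr.
Qed.

Lemma quadratic_form_comp (W : lmodType F2) (f : W -> U) q :
  linear f -> quadratic_form q -> quadratic_form (fun x => q (f x)).
Proof.
move=> lf [qZ qP]; pose F := mklin lf.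
have FE x : f x = F x by rewrite mklinE.
split=> [a x|y a x z]; first by rewrite !FE linearZ qZ.
by have := qP (F y) a (F x) (F z); rewrite /polar_form !FE !linearD linearZ.
Qed.

Lemma polar_form_diag b : (forall y, scalar (b^~ y)) ->
  (forall x, scalar (b x)) ->
  forall x y, polar_form (fun z => b z z) x y = b x y + b y x.
Proof.
move=> bl br x y; rewrite /polar_form.
have bDl u v w : b (u + v) w = b u w + b v w.
  by have /= := bl w 1 u v; rewrite scale1r mul1r.
have bDr u v w : b w (u + v) = b w u + b w v.
  by have := br w 1 u v; rewrite scale1r mul1r.
(* The two copies of [b x x] and of [b y y] are brought together and cancel in characteristic 2. *)
rewrite bDl !bDr [LHS](AC (2*2*1*1) (2*3*(1*5)*(4*6))) /=.
by rewrite !F2D !addr0.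
Qed.

(** Serves for the non-symmetric bilinear maps [pairing] and [cross] below. *)
Lemma quadratic_form_diag b : (forall y, scalar (b^~ y)) ->
  (forall x, scalar (b x)) -> quadratic_form (fun z => b z z).
Proof.
move=> bl br; split=> [a x|y a x z].
  have b0 : b 0 (a *: x) = 0.
    apply: (@addIr _ (b 0 (a *: x))).
    by rewrite add0r -{1}[b 0 _]mul1r -bl scaler0 addr0.
  have b0r : b x 0 = 0.
    by apply: (@addIr _ (b x 0)); rewrite add0r -{1}[b x 0]mul1r -br scaler0 addr0.
  rewrite -{1}[a *: x]addr0 bl b0 addr0 -[X in b x X]addr0 br b0r addr0.
  by rewrite mulrA expr2.
by rewrite !polar_form_diag // bl br addrACA -mulrDr.
Qed.
End QuadraticForms.

(** * Embedding a degenerate form in a nondegenerate one *)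

Section Hyperbolic.
Context (U : nqSpace) (q : U -> F2) (qP : quadratic_form q).

(* Nondegenerate whatever [q] is, so [(U, q)], possibly degenerate, embeds in a
   nondegenerate space. *)
Definition hyp_form (x : U * U) : F2 := polar x.1 x.2 + q x.1.

Let pairing (x y : U * U) : F2 := polar x.1 y.2.

Let pairingPl y : scalar (pairing^~ y).
Proof. by move=> a x z; rewrite /pairing polarPl. Qed.

Let pairingPr x : scalar (pairing x).
Proof. by move=> a y z; rewrite /pairing polarPr. Qed.

Lemma hyp_polar x y : polar_form hyp_form x y =
  polar x.1 y.2 + polar y.1 x.2 + polar_form q x.1 y.1.
Proof. by rewrite polar_formD (polar_form_diag pairingPl pairingPr). Qed.

Lemma hyp_quadratic : quadratic_form hyp_form.
Proof.
apply: quadratic_formD; first exact: quadratic_form_diag pairingPl pairingPr.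
exact: (@quadratic_form_comp U (U * U)%type fst).
Qed.

(** Vectors [(0, z)] see only the first component, since [q] vanishes on them; once that component
    is 0, vectors [(z, 0)] detect the second without any contribution of [q]. *)
Lemma hyp_nondegenerate : nondegenerate hyp_form.
Proof.
have q0 : q 0 = 0 by have [/(_ 0 0)] := qP; rewrite scale0r expr0n mul0r.
have pq0 y : polar_form q 0 y = 0 by rewrite /polar_form add0r q0 addr0 F2D.
have pq0r y : polar_form q y 0 = 0 by rewrite /polar_form addr0 q0 addr0 F2D.
case=> u w h.
have u0 : u = 0.
  apply: polar_inj => z; have := h (0, z).
  by rewrite hyp_polar /= polar0l pq0r !addr0 polar0l.
rewrite u0 in h *; congr (_, _); apply: polar_inj => z; have := h (z, 0).
by rewrite hyp_polar /= !polar0l pq0 addr0 add0r polarC.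
Qed.

Definition hyp : nqSpace := NqSpace hyp_quadratic hyp_nondegenerate.

Lemma hyp_inl_linear : linear (fun x : U => (x, 0) : hyp).
Proof. by move=> a x y; congr (_, _); rewrite /= scaler0 addr0. Qed.

Lemma hyp_inl_qform x : qform ((x, 0) : hyp) = q x.
Proof. by rewrite /= /hyp_form /= polar0r add0r. Qed.
End Hyperbolic.

(** * Amalgamation along a possibly degenerate subspace *)

Section Amalgamation.
Context (E : vectType F2) (X Y : nqSpace) (g : 'Hom(E, X)) (h : 'Hom(E, Y)).
Hypotheses (g_inj : lker g == 0%VS) (h_inj : lker h == 0%VS).
Hypothesis gh : forall e, qform (g e) = qform (h e).

(* The cross term making both embeddings of [qform_amalgam], [x |-> (x, 0)] and
   [y |-> (g (s y), y - h (s y))] with [s] a left inverse of [h], isometric: it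
   turns [g e] paired with [z : Y] into [polar (h e) z]. *)
Let cross (x y : osum X Y) : F2 := polar (h ((g^-1)%VF x.1)) y.2.

Let crossPl y : scalar (cross^~ y).
Proof. by move=> a x z; rewrite /cross /= !linearP polarPl. Qed.

Let crossPr x : scalar (cross x).
Proof. by move=> a y z; rewrite /cross /= polarPr. Qed.

Let Q (x : osum X Y) : F2 := qform x + cross x x.

Let Q_quadratic : quadratic_form Q.
Proof. exact: quadratic_formD (qformP _) (quadratic_form_diag crossPl crossPr). Qed.

(** [Q] may be degenerate, whence the passage to [hyp]. The two embeddings agree on [E] because
    [s (h e) = e] sends [h e] to [(g e, 0)]. *)
Lemma qform_amalgam : exists (P : nqSpace) (a : qhom X P) (b : qhom Y P),
  forall e, a (g e) = b (h e).
Proof.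
pose af x : hyp Q_quadratic := ((x, 0) : osum X Y, 0).
have la : linear af.
  by move=> c x y; rewrite /af -hyp_inl_linear; congr (_, _); exact: osum_inl_linear.
have qa x : qform (af x) = qform x.
  by rewrite hyp_inl_qform /Q osum_inl_qform /cross /= polar0r addr0.
pose s (y : Y) := (h^-1)%VF y.
pose bf y : hyp Q_quadratic := ((g (s y), y - h (s y)) : osum X Y, 0).
have lb : linear bf.
  move=> c x y; rewrite /bf -hyp_inl_linear; congr (_, _); congr (_, _) => /=.
    by rewrite /s !linearP.
  by rewrite /s !linearP /= scalerDr addrACA.
have qb y : qform (bf y) = qform y.
  (* By [gh], this is the expansion of [qform] at [h (s y) + (y - h (s y))], the cross term being
     the polar form. *)
  rewrite hyp_inl_qform /Q /cross /= /osum_form /= lker0_lfunK // gh -qformD.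
  by rewrite addrC subrK.
exists (hyp Q_quadratic), (mkqhom la qa), (mkqhom lb qb) => e.
by rewrite !mkqhomE /af /bf /s lker0_lfunK // subrr.
Qed.
End Amalgamation.

(** * Morphisms of rank 0 *)

Lemma dg_rank0 V W (d : diagram V W) : dg_rank d = 0%N ->
  forall v w, dg_l d v + dg_r d w = 0 -> v = 0 /\ w = 0.
Proof.
move=> /eqP; rewrite dimv_eq0 => /eqP d0 v w e.
have lr : dg_l d v = dg_r d (- w) by rewrite linearN; apply/eqP; rewrite -addr_eq0 e.
have : dg_l d v \in (limg (dg_l d) :&: limg (dg_r d))%VS.
  by apply/memv_capP; split; [|rewrite lr]; exact: memv_img (memvf _).
rewrite d0 memv0 => /eqP v0; move: e; rewrite v0 add0r => w0.
by split; apply: qhom_inj; rewrite linear0; [exact: v0 | exact: w0].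
Qed.

Lemma dg_eq_rank0 V W (d e : diagram V W) : dg_rank d = 0%N -> dg_rank e = 0%N ->
  (forall v w, polar (dg_l d v) (dg_r d w) = polar (dg_l e v) (dg_r e w)) ->
  dg_eq d e.
Proof.
case: d e => [X f g] [Y h k] /dg_rank0 /= df /dg_rank0 /= dh pol.
have lin (Z : nqSpace) (m : qhom V Z) (n : qhom W Z) :
    linear (fun x : V * W => m x.1 + n x.2).
  by move=> a x y; rewrite !linearP /= scalerDr addrACA.
have inj (Z : nqSpace) (m : qhom V Z) (n : qhom W Z) :
    (forall v w, m v + n w = 0 -> v = 0 /\ w = 0) -> lker (lfun_of (lin Z m n)) == 0%VS.
  move=> mn; rewrite -subv0; apply/subvP => -[v w]; rewrite memv_ker lfun_ofE memv0.
  by move=> /eqP /= /mn[-> ->].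
(* Amalgamation along [V * W], where both diagrams induce [qform v + qform w] plus the common
   pairing [pol]. *)
have [|P [a [b ab]]] := qform_amalgam (inj _ _ _ df) (inj _ _ _ dh).
  by move=> [v w]; rewrite !lfun_ofE /= !qformD !qmapP pol.
apply: (@DgTrans _ _ _ (Diagram (qcomp a f) (qcomp a g))); first exact: DgStep.
apply: DgSym; have -> : qcomp a f = qcomp b h.
  apply: qhom_ext => v; rewrite !qcompE.
  by have := ab (v, 0); rewrite !lfun_ofE /= !linear0 !addr0.
have -> : qcomp a g = qcomp b k.
  apply: qhom_ext => w; rewrite !qcompE.
  by have := ab (0, w); rewrite !lfun_ofE /= !linear0 !add0r.
exact: DgStep.
Qed.

Lemma tq_rank0_inj V W (u v : tq_hom V W) : tq_rank u = 0%N -> tq_rank v = 0%N ->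
  eps_map u = eps_map v -> u = v.
Proof.
have [d ->] := tq_mk_surj u; have [e ->] := tq_mk_surj v.
rewrite !tq_rankE => d0 e0 de; apply/tq_mk_eq/dg_eq_rank0 => // x y.
by rewrite -!eps_map_polar de.
Qed.

Lemma tq_rank0_surj (V W : nqSpace) (p : 'Hom(V, W)) :
  exists u : tq_hom V W, tq_rank u = 0%N /\ eps_map u = p.
Proof.
(* The summand [qform (p v)] offsets the form of the component [p v] of [f v], so that [f] is
   isometric. *)
have qP : quadratic_form (fun v : V => qform v + qform (p v)).
  exact: quadratic_formD (qformP _) (quadratic_form_comp (linearP p) (qformP _)).
pose f v : osum W (hyp qP) := (p v, (v, 0)).
have lf : linear f.
  by move=> a x y; congr (_, _); [rewrite linearP | exact: hyp_inl_linear].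
have qf v : qform (f v) = qform v.
  by rewrite /= /osum_form hyp_inl_qform /= addrCA F2D addr0.
exists (tq_mk (sd_dg (SplitDiagram (mkqhom lf qf)))); split; last first.
  by rewrite eps_map_split; apply/lfunP => v; rewrite comp_lfunE osum_fstE mkqhomE.
rewrite tq_rankE /dg_rank; apply/eqP; rewrite dimv_eq0 -subv0; apply/subvP => x.
case/memv_capP=> /memv_imgP[v _ ->] /memv_imgP[w _] /=.
rewrite !lfun_ofE /f => -[_ v0].
by rewrite v0 linear0 memv0.
Qed.

(** * Linearisation of [eps] and of its rank 0 section *)

Section Linearisation.
Context (V : Tq).

(** By [tq_rank0_inj] the chosen preimage is the only one of rank 0. *)
Definition tq_lift (W : Tq) (p : 'Hom(eps V, eps W)) : tq_hom V W :=
  projT1 (cid (tq_rank0_surj p)).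

Lemma tq_lift_rank W (p : 'Hom(eps V, eps W)) : tq_rank (tq_lift p) = 0%N.
Proof. by rewrite /tq_lift; case: cid => u []. Qed.

Lemma eps_tq_lift W (p : 'Hom(eps V, eps W)) : eps_map (tq_lift p) = p.
Proof. by rewrite /tq_lift; case: cid => u []. Qed.

Lemma tq_lift_eps W (u : tq_hom V W) : tq_rank u = 0%N -> tq_lift (eps_map u) = u.
Proof. by move=> u0; apply: tq_rank0_inj; rewrite ?tq_lift_rank ?eps_tq_lift. Qed.

Definition free_eps (W : Tq) : {linear PTq V W -> iotaF (PF (eps V)) W} :=
  mklin (fglift_linear (fun u : {classic (tq_hom V W)} =>
    @freehom_gen fdVect (eps V) (eps W) (eps_map u))).

Lemma free_epsE (W : Tq) (u : tq_hom V W) :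
  free_eps W (@freehom_gen Tq V W u) = @freehom_gen fdVect (eps V) (eps W) (eps_map u).
Proof. by rewrite /free_eps mklinE liftU scale1r. Qed.

Definition free_lift (W : Tq) : {linear iotaF (PF (eps V)) W -> PTq V W} :=
  mklin (fglift_linear (fun p : {classic 'Hom(eps V, eps W)} =>
    @freehom_gen Tq V W (tq_lift p))).

Lemma free_liftE (W : Tq) (p : 'Hom(eps V, eps W)) :
  free_lift W (@freehom_gen fdVect (eps V) (eps W) p) = @freehom_gen Tq V W (tq_lift p).
Proof. by rewrite /free_lift mklinE liftU scale1r. Qed.

Lemma free_eps_natural (X Y : Tq) (f : hom X Y) x :
  fmap (iotaF (PF (eps V))) f (free_eps X x) = free_eps Y (fmap (PTq V) f x).
Proof.
pose F : {linear PTq V X -> _} := fmap (iotaF (PF (eps V))) f \o free_eps X.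
pose G : {linear PTq V X -> _} := free_eps Y \o fmap (PTq V) f.
suff FG : F = G by rewrite -[LHS]/(F x) FG.
apply: freehom_ext => u.
rewrite -[LHS]/(fmap (iotaF (PF (eps V))) f (free_eps X (@freehom_gen Tq V X u))).
rewrite -[RHS]/(free_eps Y (freehom_map V f (@freehom_gen Tq V X u))).
rewrite free_epsE [LHS](@freehom_mapE fdVect) freehom_mapE free_epsE.
by congr freehom_gen; rewrite [RHS]eps_mapM.
Qed.

Lemma free_liftK (W : Tq) : cancel (free_lift W) (free_eps W).
Proof.
move=> y; pose F : {linear iotaF (PF (eps V)) W -> _} := free_eps W \o free_lift W.
suff FG : F = idfun by rewrite -[LHS]/(F y) FG.
apply: freehom_ext => p.
rewrite -[LHS]/(free_eps W (free_lift W (@freehom_gen fdVect (eps V) (eps W) p))).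
by rewrite free_liftE free_epsE eps_tq_lift.
Qed.

Lemma free_epsK (W : Tq) (x : PTq V W) :
  PTq_rank V 0 W x -> free_lift W (free_eps W x) = x.
Proof.
case=> s sr ->; rewrite !linear_sum; apply: eq_big_seq => p /sr[u].
rewrite leqn0 => /eqP u0 ->; rewrite !linearZ; congr (_ *: _).
rewrite -[LHS]/(free_lift W (free_eps W (@freehom_gen Tq V W u))).
by rewrite free_epsE free_liftE tq_lift_eps.
Qed.

Lemma free_lift_rank (W : Tq) (y : iotaF (PF (eps V)) W) :
  PTq_rank V 0 W (free_lift W y).
Proof.
(* The expansion of [y] in the basis, with each generator lifted. *)
exists [seq (coeff p y, @freehom_gen Tq V W (tq_lift p)) | p <- dom y].
  move=> _ /mapP[p _ ->]; exists (tq_lift p) => //=.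
  by rewrite tq_lift_rank.
rewrite big_map -{1}[y]freeg_sumE linear_sum; apply: eq_bigr => p _.
by rewrite /free_lift mklinE liftU.
Qed.
End Linearisation.

Theorem theorem2p6 (V : Tq) :
  nat_iso (sub_functor (PTq_rank V 0)) (iotaF (PF (eps V))) /\
  direct_summand (PTq_rank V 0).
Proof.
split; last first.
  have T0 W : free_eps V W 0 = 0 by exact: linear0.
  have Tlin W a (x y : PTq V W) : free_eps V W x = 0 -> free_eps V W y = 0 ->
    free_eps V W (a *: x + y) = 0 by move=> x0 y0; rewrite linearP x0 y0 scaler0 addr0.
  have Tmap X Y (f : hom X Y) x : free_eps V X x = 0 ->
    free_eps V Y (fmap (PTq V) f x) = 0 by move=> x0; rewrite -free_eps_natural x0 linear0.
  exists (@Subfunctor Tq (PTq V) (fun W => Submodule (T0 W) (Tlin W)) Tmap) => W; split.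
    by move=> x Sx Tx; rewrite -(free_epsK Sx) (Tx : free_eps V W x = 0) linear0.
  (* [free_lift] after [free_eps] is the projection onto the rank 0 part along the kernel. *)
  move=> x; exists (free_lift V W (free_eps V W x)), (x - free_lift V W (free_eps V W x)).
  split; first exact: free_lift_rank.
    by apply: etrans (linearB (free_eps V W) _ _) _; rewrite free_liftK subrr.
  by rewrite addrC subrK.
pose a W : {linear sm_type (PTq_rank V 0 W) -> iotaF (PF (eps V)) W} :=
  free_eps V W \o sm_incl (PTq_rank V 0 W).
have aP X Y (f : hom X Y) : cmp (fmap (iotaF (PF (eps V))) f) (a X : hom (_ : Vect) _) =
    cmp (a Y : hom (_ : Vect) _) (fmap (sub_functor (PTq_rank V 0)) f).
  by apply: linear_ext => x; exact: free_eps_natural.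
pose bf W (y : iotaF (PF (eps V)) W) : sm_type (PTq_rank V 0 W) :=
  SmType (asboolT (free_lift_rank y)).
have lb W : linear (@bf W) by move=> c x y; apply: val_inj; exact: linearP.
pose b W : {linear iotaF (PF (eps V)) W -> sm_type (PTq_rank V 0 W)} := mklin (lb W).
have ab W x : a W (b W x) = x by exact: free_liftK.
have ba W x : b W (a W x) = x.
  by apply: val_inj; apply: free_epsK; exact/asboolP/sm_valP.
have bP X Y (f : hom X Y) :
    cmp (fmap (sub_functor (PTq_rank V 0)) f) (b X : hom (_ : Vect) _) =
    cmp (b Y : hom (_ : Vect) _) (fmap (iotaF (PF (eps V))) f).
  (* Naturality of [b] follows from that of [a], as they are mutually inverse. *)
  apply: linear_ext => y; rewrite -[LHS]ba; congr (b Y _).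
  by rewrite -{2}[y]ab; apply: esym; exact: free_eps_natural.
exists (@NatTrans _ _ (sub_functor (PTq_rank V 0)) (iotaF (PF (eps V))) a aP).
exists (@NatTrans _ _ (iotaF (PF (eps V))) (sub_functor (PTq_rank V 0)) b bP) => W.
by split; apply: linear_ext => x; [exact: ba | exact: ab].
Qed.
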